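(* The family $\mathcal{L}(\mathrm{IND}_{\mathrm{UFIN}_1})$ is a full trio that is closed under union, and it contains all bounded Ginsburg semi-linear languages.
   Context: An indexed grammar is a 5-tuple $G=(V,T,I,P,S)$ where $V,T,I$ are finite pairwise disjoint sets (variables, terminals, indices), $S\in V$ is the start variable, and $P$ is a finite set of productions of the forms (1) $A\to\nu$, (2) $A\to Bf$, (3) $Af\to\nu$, with $A,B\in V$, $f\in I$, $\nu\in(V\cup T)^*$. Sentential forms are words in $(VI^*\cup T)^*$. In one derivation step $\Rightarrow$, an occurrence $A\alpha$ in a sentential form ($A\in V$, $\alpha\in I^*$ the maximal word of indices following it) is replaced as follows: by (1) $A\to w_1C_1\cdots w_\ell C_\ell w_{\ell+1}$ ($w_j\in T^*$, $C_j\in V$), it is replaced by $w_1C_1\alpha\cdots w_\ell C_\ell\alpha w_{\ell+1}$; by (2) $A\to Bf$, it is replaced by $Bf\alpha$; by (3) $Af\to w_1C_1\cdots w_\ell C_\ell w_{\ell+1}$, if $\alpha=f\alpha'$, it is replaced by $w_1C_1\alpha'\cdots w_\ell C_\ell\alpha' w_{\ell+1}$. The generated language is $L(G)=\{u\in T^*: S\Rightarrow^* u\}$. A production is special if its right-hand side contains at least 2 occurrences of variables. $\mathcal{L}(\mathrm{IND}_{\mathrm{UFIN}_1})$ is the family of languages generated by indexed grammars $G$ such that in every successful derivation (a derivation from $S$ of a word of $L(G)$) at most one application of a special production occurs. A full trio is a family of languages closed under (possibly erasing) morphism, inverse morphism, and intersection with regular languages. A language $L$ is bounded if there are non-empty words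 $u_1,\dots,u_k$ ($k\ge1$) with $L\subseteq u_1^*\cdots u_k^*$. A linear subset of $\mathbb{N}^k$ is one of the form $b_0+\{x_1b_1+\cdots+x_nb_n: x_i\in\mathbb{N}\}$ with $b_i\in\mathbb{N}^k$; a semi-linear set is a finite union of linear sets. A bounded language $L\subseteq u_1^*\cdots u_k^*$ is bounded Ginsburg semi-linear if there is a semi-linear $B\subseteq\mathbb{N}^k$ with $L=\varphi(B)$, where $\varphi(\ell_1,\dots,\ell_k)=u_1^{\ell_1}\cdots u_k^{\ell_k}$. *)

(* Defs.v *)
From HB Require Import structures.
From mathcomp Require Import all_boot all_order all_algebra.
From mathcomp Require Import boolp classical_sets.

Set Implicit Arguments.
Unset Strict Implicit.
Unset Printing Implicit Defensive.

Import GRing.Theory.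

Local Open Scope classical_set_scope.

Definition language (T : Type) : Type := set (seq T).

(** Alphabets are finite types, so a family of languages is indexed by the
    alphabet over which its members are regarded as languages. *)
Definition language_family : Type := forall T : finType, set (language T).

Section Production.
Variables T V I : Type.

(** [Plain A nu] is A -> nu, [Push A B f] is A -> B f, [Pop A f nu] is
    A f -> nu.  Variables and terminals are the two sides of a sum type, which
    makes the alphabets disjoint. *)
Inductive production : Type :=
| Plain of V & seq (V + T)
| Push of V & V & I
| Pop of V & I & seq (V + T).

Definition production_encode (p : production) :
    (V * seq (V + T)) + (V * V * I) + (V * I * seq (V + T)) :=
  match p with
  | Plain A nu => inl (inl (A, nu))
  | Push A B f => inl (inr (A, B, f))
  | Pop A f nu => inr (A, f, nu)
  end.

Definition production_decode
    (c : (V * seq (V + T)) + (V * V * I) + (V * I * seq (V + T))) :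
    production :=
  match c with
  | inl (inl (A, nu)) => Plain A nu
  | inl (inr (A, B, f)) => Push A B f
  | inr (A, f, nu) => Pop A f nu
  end.

Lemma production_encodeK : cancel production_encode production_decode.
Proof. by case. Qed.

Definition rhs_variables (p : production) : nat :=
  match p with
  | Plain _ nu | Pop _ _ nu => count (fun x => if x is inl _ then true else false) nu
  | Push _ _ _ => 1
  end.

Definition special (p : production) : bool := 2 <= rhs_variables p.

(** A word of (V I^* + T)^* factors uniquely into terminals and blocks
    A alpha with alpha the maximal index word following A; such a block is the
    pair (A, alpha), so maximality of alpha is built in. *)
Definition sentential : Type := seq (V * seq I + T).

Definition distribute (alpha : seq I) (nu : seq (V + T)) : sentential :=
  [seq match x with inl C => inl (C, alpha) | inr a => inr a end | x <- nu].

Inductive rewrites : production -> V -> seq I -> sentential -> Prop :=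
| rewrites_plain A nu alpha :
    rewrites (Plain A nu) A alpha (distribute alpha nu)
| rewrites_push A B f alpha :
    rewrites (Push A B f) A alpha [:: inl (B, f :: alpha)]
| rewrites_pop A f nu alpha :
    rewrites (Pop A f nu) A (f :: alpha) (distribute alpha nu).

End Production.

HB.instance Definition _ (T V I : eqType) :=
  Equality.copy (production T V I) (can_type (@production_encodeK T V I)).

Record indexed_grammar (T : finType) : Type := IndexedGrammar {
  variables : finType;
  indices : finType;
  productions : seq (production T variables indices);
  start : variables
}.

Section Derivation.
Variables (T : finType) (G : indexed_grammar T).

Local Notation prod := (production T (variables G) (indices G)).
Local Notation sform := (sentential T (variables G) (indices G)).

Inductive step : sform -> prod -> sform -> Prop :=
| Step p A alpha w x y :
    p \in productions G -> rewrites p A alpha w ->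
    step (x ++ inl (A, alpha) :: y) p (x ++ w ++ y).

(** [derivation x ps y]: x =>^* y applying successively the productions [ps]. *)
Inductive derivation : sform -> seq prod -> sform -> Prop :=
| derivation_nil x : derivation x [::] x
| derivation_cons x p y ps z :
    step x p y -> derivation y ps z -> derivation x (p :: ps) z.

Definition successful (ps : seq prod) (u : seq T) : Prop :=
  derivation [:: inl (start G, [::])] ps [seq inr a | a <- u].

Definition generated : language T := [set u | exists ps, successful ps u].

Definition ufin1 : Prop :=
  forall ps u, successful ps u -> count (@special _ _ _) ps <= 1.

End Derivation.

Definition IND_UFIN1 : language_family := fun T =>
  [set L | exists2 G : indexed_grammar T, ufin1 G & L = generated G].

Arguments IND_UFIN1 : clear implicits.

Definition is_morphism (T1 T2 : Type) (h : seq T1 -> seq T2) : Prop :=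
  h [::] = [::] /\ forall u v, h (u ++ v) = h u ++ h v.

Definition regular (T : finType) (R : language T) : Prop :=
  exists (Q : finType) (q0 : Q) (delta : Q -> T -> Q) (final : pred Q),
    R = [set w | final (foldl delta q0 w)].

Definition closed_morphism (F : language_family) : Prop :=
  forall (T1 T2 : finType) (h : seq T1 -> seq T2) (L : language T1),
    is_morphism h -> F T1 L -> F T2 (h @` L).

Definition closed_inverse_morphism (F : language_family) : Prop :=
  forall (T1 T2 : finType) (h : seq T1 -> seq T2) (L : language T2),
    is_morphism h -> F T2 L -> F T1 (h @^-1` L).

Definition closed_regular_intersection (F : language_family) : Prop :=
  forall (T : finType) (L R : language T),
    regular R -> F T L -> F T (L `&` R).

Definition full_trio (F : language_family) : Prop :=
  [/\ closed_morphism F, closed_inverse_morphism F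
    & closed_regular_intersection F].

Definition closed_union (F : language_family) : Prop :=
  forall (T : finType) (L1 L2 : language T),
    F T L1 -> F T L2 -> F T (L1 `|` L2).

Definition linear_set (k : nat) (B : set 'rV[nat]_k) : Prop :=
  exists (n : nat) (b0 : 'rV[nat]_k) (b : 'I_n -> 'rV[nat]_k),
    B = [set (b0 + \sum_(i < n) b i *+ x i)%R | x in [set: 'I_n -> nat]].

Definition semilinear_set (k : nat) (B : set 'rV[nat]_k) : Prop :=
  exists (m : nat) (C : 'I_m -> set 'rV[nat]_k),
    (forall j, linear_set (C j)) /\ B = \bigcup_j C j.

Definition word_power (T : Type) (u : seq T) (n : nat) : seq T :=
  flatten (nseq n u).

Definition word_star (T : Type) (u : seq T) : language T :=
  range (word_power u).

Definition concat (T : Type) (L1 L2 : language T) : language T :=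
  [set u ++ v | u in L1 & v in L2].

Definition bounded_by (T : Type) (k : nat) (u : 'I_k -> seq T)
    (L : language T) : Prop :=
  [/\ 0 < k, forall i, u i <> [::]
    & L `<=` \big[@concat T/[set [::]]]_(i < k) word_star (u i)].

Definition word_powers (T : Type) (k : nat) (u : 'I_k -> seq T)
    (l : 'rV[nat]_k) : seq T :=
  \big[cat/[::]]_(i < k) word_power (u i) (l ord0 i).

Definition bounded_ginsburg_semilinear (T : finType) (L : language T) : Prop :=
  exists (k : nat) (u : 'I_k -> seq T), bounded_by u L /\
    exists2 B : set 'rV[nat]_k, semilinear_set B & L = word_powers u @` B.

(* Main.v *)
(** A derivation of a terminal word is a forest whose subtrees are independent,
    so it is counted compositionally: the number of special productions applied
    adds up over the blocks [A alpha] of a sentential form. Hence a construction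
    preserves the bound 1 as soon as each of its trees projects to a tree of the
    original grammar using at least as many special productions.

    The full trio operations are all images under finite transducers (a
    morphism, the inverse of a morphism, a partial identity), and the triple
    construction can be arranged to split a right-hand side only where the
    original production is special. For a linear set, the index stack records
    which periods are used, and one special production copies it to [k]
    readers, one for each word [u j]. *)

Require Import Defs.
From mathcomp Require Import all_boot.
From mathcomp Require Import all_algebra.
From mathcomp Require Import boolp classical_sets.
From mathcomp Require Import zify.

Set Implicit Arguments.
Unset Strict Implicit.
Unset Printing Implicit Defensive.

Local Open Scope classical_set_scope.

(** * Finite grammars from bounded predicates on productions *)

Definition rhs_size (T V I : Type) (p : production T V I) : nat :=
  match p with Plain _ nu | Pop _ _ nu => size nu | Push _ _ _ => 1 end.

(** Right-hand sides of length at most [K] form a finite type, so the candidate productions can be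
    enumerated and then filtered classically by [P]. Grammars can thus be specified by inductive
    predicates. *)
Lemma finite_productions (T V I : finType) (P : production T V I -> Prop)
    (K : nat) :
  (forall p, P p -> rhs_size p <= K) ->
  exists ps : seq (production T V I), forall p, p \in ps <-> P p.
Proof.
move=> bP.
pose dec (c : V * K.-bseq (V + T)%type + V * V * I
              + V * I * K.-bseq (V + T)%type) :=
  match c with
  | inl (inl (A, nu)) => Plain _ A nu
  | inl (inr (A, B, f)) => Push _ A B f
  | inr (A, f, nu) => Pop A f nu
  end.
exists [seq p <- codom dec | `[< P p >]] => p.
rewrite mem_filter; split=> [/andP[/asboolP//]|Pp].
apply/andP; split; first exact/asboolP.
apply/codomP; have := bP p Pp; case: p {Pp} => [A nu|A B f|A f nu] /= le_nu.
- by exists (inl (inl (A, Bseq le_nu))).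
- by exists (inl (inr (A, B, f))).
- by exists (inr (A, f, Bseq le_nu)).
Qed.

(** * Derivation forests and the count of special productions *)

Section Yields.
Variables (T V I : Type).
Implicit Types (P : production T V I -> Prop) (x y w : sentential T V I).

(** The number counts the special productions applied. *)
Inductive yields P : nat -> sentential T V I -> seq T -> Prop :=
| yields_nil : yields P 0 [::] [::]
| yields_terminal n a x u : yields P n x u -> yields P n (inr a :: x) (a :: u)
| yields_variable p A alpha w n1 u1 n2 x u2 :
    P p -> rewrites p A alpha w -> yields P n1 w u1 -> yields P n2 x u2 ->
    yields P (special p + n1 + n2) (inl (A, alpha) :: x) (u1 ++ u2).

Lemma yields_step P p A alpha w n u :
  P p -> rewrites p A alpha w -> yields P n w u ->
  yields P (special p + n) [:: inl (A, alpha)] u.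
Proof.
move=> Pp rw ywu; rewrite -[special p + n]addn0 -[u]cats0.
by apply: yields_variable rw ywu _; [|exact: yields_nil].
Qed.

Lemma yields_cat P n1 x u1 n2 y u2 :
  yields P n1 x u1 -> yields P n2 y u2 -> yields P (n1 + n2) (x ++ y) (u1 ++ u2).
Proof.
elim=> [//|n a {}x u _ IH /IH|p A alpha w m1 v1 m2 {}x v2 Pp rw y1 _ _ IH /IH].
  exact: yields_terminal.
by move=> yx; rewrite -catA -addnA; exact: yields_variable rw y1 yx.
Qed.

Lemma yields_terminals P (u : seq T) : yields P 0 [seq inr a | a <- u] u.
Proof. by elim: u => [|a u IH]; [exact: yields_nil|exact: yields_terminal]. Qed.

Lemma yields_catP P n x y u :
  yields P n (x ++ y) u -> exists n1 n2 u1 u2,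
    [/\ yields P n1 x u1, yields P n2 y u2, n = n1 + n2 & u = u1 ++ u2].
Proof.
elim: x n u => [|s x IH] n u /=.
  by move=> yu; exists 0, n, [::], u; split=> //; exact: yields_nil.
move=> H; inversion H as [|m a z v yzv|p A alpha w m1 v1 m2 z v2 Pp rw y1 y2]; subst.
  have [n1 [n2 [u1 [u2 [yx yy -> ->]]]]] := IH _ _ yzv.
  by exists n1, n2, (a :: u1), u2; split=> //; exact: yields_terminal.
have [n1 [n2 [w1 [w2 [yx yy -> ->]]]]] := IH _ _ y2.
exists (special p + m1 + n1), n2, (v1 ++ w1), w2; split; rewrite ?catA ?addnA //.
exact: yields_variable rw y1 yx.
Qed.

Lemma yields_variableP P n A alpha u :
  yields P n [:: inl (A, alpha)] u -> exists p w n1,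
    [/\ P p, rewrites p A alpha w, yields P n1 w u & n = special p + n1].
Proof.
move=> H; inversion H as [|m a z v yzv|p A' alpha' w m1 v1 m2 z v2 Pp rw y1 y2]; subst.
inversion y2; subst; exists p, w, m1; split=> //; first by rewrite cats0.
by rewrite addn0.
Qed.

(** Extends an interpretation [sem] of single blocks to sentential forms: counts add up and words
    are concatenated. Each grammar below is analysed by choosing an invariant [sem]. *)
Fixpoint form_sem (sem : V -> seq I -> nat -> seq T -> Prop)
    (x : sentential T V I) (n : nat) (u : seq T) : Prop :=
  match x with
  | [::] => n = 0 /\ u = [::]
  | inr a :: x' => exists2 u', u = a :: u' & form_sem sem x' n u'
  | inl (A, alpha) :: x' => exists n1 n2 u1 u2,
      [/\ n = n1 + n2, u = u1 ++ u2, sem A alpha n1 u1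
        & form_sem sem x' n2 u2]
  end.

(** [yields] is the least interpretation closed under the productions, so an invariant has to be
    checked on one production at a time. *)
Lemma yields_sound P sem :
  (forall p A alpha w n u, P p -> rewrites p A alpha w -> form_sem sem w n u ->
     sem A alpha (special p + n) u) ->
  forall n x u, yields P n x u -> form_sem sem x n u.
Proof.
move=> hP n x u; elim=> {n x u} [//|n a x u _ IH|] /=; first by exists u.
move=> p A alpha w n1 u1 n2 x u2 Pp rw _ IH1 _ IH2.
by exists (special p + n1), n2, u1, u2; split=> //; apply: hP rw IH1.
Qed.

Lemma form_sem_terminals sem (v : seq T) x n u :
  form_sem sem ([seq inr a | a <- v] ++ x) n u ->
  exists2 u', u = v ++ u' & form_sem sem x n u'.
Proof.
elim: v u => [|a v IH] u /=; first by exists u.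
by move=> [u' -> /IH[u'' -> sx]]; exists u''.
Qed.

Lemma form_sem_variable sem A alpha n u :
  form_sem sem [:: inl (A, alpha)] n u = sem A alpha n u.
Proof.
apply/propext; split=> /=.
  by move=> [n1 [n2 [u1 [u2 [-> -> sA [-> ->]]]]]]; rewrite addn0 cats0.
by move=> sA; exists n, 0, u, [::]; rewrite addn0 cats0.
Qed.

Lemma distribute_cat (alpha : seq I) (nu1 nu2 : seq (V + T)) :
  distribute alpha (nu1 ++ nu2) = distribute alpha nu1 ++ distribute alpha nu2.
Proof. exact: map_cat. Qed.

Lemma distribute_terminals (alpha : seq I) (v : seq T) :
  distribute alpha [seq inr a | a <- v] = [seq @inr (V * seq I) T a | a <- v].
Proof. by rewrite /distribute -map_comp. Qed.

End Yields.

Lemma derivation_context (T : finType) (G : indexed_grammar T) l r x ps y :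
  derivation x ps y -> @derivation T G (l ++ x ++ r) ps (l ++ y ++ r).
Proof.
elim=> [z|{}x p {}y {}ps z st _ IH]; first exact: derivation_nil.
apply: derivation_cons IH; case: st => q A alpha w x1 y1 qG rw.
by have := Step (l ++ x1) (y1 ++ r) qG rw; rewrite -!catA.
Qed.

Lemma derivation_trans (T : finType) (G : indexed_grammar T) x ps y qs z :
  derivation x ps y -> derivation y qs z -> @derivation T G x (ps ++ qs) z.
Proof.
by elim=> [//|a p b rs c st _ IH /IH]; apply: derivation_cons.
Qed.

(** The forest of the form after a step splits along the context of that step, and its middle part
    becomes the children of the rewritten block. The order of the steps is lost, their special count
    is not. *)
Lemma derivation_yields (T : finType) (G : indexed_grammar T) x ps u :
  @derivation T G x ps [seq inr a | a <- u] ->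
  yields (fun p => p \in productions G) (count (@special _ _ _) ps) x u.
Proof.
move e: [seq inr a | a <- u] => y D; elim: D e => [z <-|{}x p z {}ps {}y st _ IH e].
  exact: yields_terminals.
have {}IH := IH e; case: st IH => q A alpha w l r qG rw /=.
move=> /yields_catP[n1 [n' [u1 [u' [yl]]]]].
move=> /yields_catP[n2 [n3 [u2 [u3 [yw yr -> ->]]]]] -> ->.
have -> : special q + (n1 + (n2 + n3)) = n1 + (special q + n2 + n3) by lia.
by apply: (yields_cat yl); apply: yields_variable rw yw yr.
Qed.

(** A forest is flattened in leftmost order: a block is rewritten down to terminals before the rest
    of the form is touched. *)
Lemma yields_derivation (T : finType) (G : indexed_grammar T) n x u :
  yields (fun p => p \in productions G) n x u ->
  exists2 ps, @derivation T G x ps [seq inr a | a <- u]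
    & count (@special _ _ _) ps = n.
Proof.
elim=> {n x u} [|n a x u _ [ps D <-]|].
- by exists [::] => //; exact: derivation_nil.
- exists ps => //.
  by have := derivation_context [:: inr a] [::] D; rewrite !cats0.
move=> p A alpha w n1 u1 n2 x u2 pG rw _ [ps1 D1 <-] _ [ps2 D2 <-].
exists (p :: ps1 ++ ps2); last by rewrite /= count_cat addnA.
apply: (derivation_cons (Step [::] x pG rw)); rewrite /= map_cat.
apply: (derivation_trans (derivation_context [::] x D1)) => /=.
by have := derivation_context [seq inr a | a <- u1] [::] D2; rewrite !cats0.
Qed.

Definition bounded_productions (T V I : Type) (P : production T V I -> Prop) :=
  exists K, forall p, P p -> rhs_size p <= K.

(** Forests and derivations have the same words and the same special counts, so membership in the
    family can be shown on forests, with a predicate in place of a list of productions. *)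
Lemma IND_UFIN1_intro (T V I : finType) (P : production T V I -> Prop) (S : V)
    (L : language T) :
  bounded_productions P ->
  (forall n u, yields P n [:: inl (S, [::])] u -> n <= 1) ->
  (forall u, L u <-> exists n, yields P n [:: inl (S, [::])] u) ->
  IND_UFIN1 T L.
Proof.
move=> [K bP] le1 LP; have [ps psP] := finite_productions bP.
have eP : (fun p => p \in ps : Prop) = P by apply/funext => p; apply/propext.
exists (IndexedGrammar ps S) => [qs u /derivation_yields /=|].
  by rewrite eP => /le1.
apply/seteqP; split=> u; rewrite /generated /= LP.
  move=> [n]; rewrite -eP => yu.
  by have [qs D _] := @yields_derivation T (IndexedGrammar ps S) _ _ _ yu; exists qs.
move=> [qs /derivation_yields yu]; exists (count (@special _ _ _) qs).
by move: yu; rewrite /= eP.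
Qed.

Lemma IND_UFIN1_elim (T : finType) (L : language T) :
  IND_UFIN1 T L ->
  exists (V I : finType) (P : production T V I -> Prop) (S : V),
  [/\ bounded_productions P,
      forall n u, yields P n [:: inl (S, [::])] u -> n <= 1
    & forall u, L u <-> exists n, yields P n [:: inl (S, [::])] u].
Proof.
move=> [G fin ->].
exists (variables G), (indices G), (fun p => p \in productions G), (start G); split.
- exists (\max_(p <- productions G) rhs_size p) => p pG.
  exact: leq_bigmax_seq.
- by move=> n u /yields_derivation[ps D <-]; apply: fin D.
move=> u; split=> [[ps /derivation_yields yu]|[n /yields_derivation[ps D _]]].
  by exists (count (@special _ _ _) ps).
by exists ps.
Qed.

(** * Finite transducers and the triple construction *)

Section Transducer.
Variables (T1 T2 Q : Type) (delta : Q -> option T1 -> seq T2 -> Q -> Prop).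

Inductive transduces : Q -> seq T1 -> seq T2 -> Q -> Prop :=
| transduces_nil q : transduces q [::] [::] q
| transduces_cons q o v q1 u w q2 :
    delta q o v q1 -> transduces q1 u w q2 ->
    transduces q (seq_of_opt o ++ u) (v ++ w) q2.

Lemma transduces_cat q u v q1 u' v' q2 :
  transduces q u v q1 -> transduces q1 u' v' q2 ->
  transduces q (u ++ u') (v ++ v') q2.
Proof.
elim=> [//|{}q o w q3 {}u {}v q4 dq _ IH /IH]; rewrite -!catA.
exact: transduces_cons.
Qed.

Lemma transduces1 q o v q1 : delta q o v q1 -> transduces q (seq_of_opt o) v q1.
Proof.
move=> dq; rewrite -[v]cats0 -[seq_of_opt o]cats0.
exact: transduces_cons dq (transduces_nil _).
Qed.

Lemma transduces_catP q u u' w q2 :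
  transduces q (u ++ u') w q2 -> exists q1 v v',
    [/\ transduces q u v q1, transduces q1 u' v' q2 & w = v ++ v'].
Proof.
move e: (u ++ u') => z tz; elim: tz u u' e => {q z w q2}
    [q|q o v q1 z w q2 dq tz IH] u u' e.
  case: u e => [/= ->|//].
  by exists q, [::], [::]; split=> //; exact: transduces_nil.
case: o dq e => [b|] dq /= e.
  case: u e => [e|c u [-> e]].
    exists q, [::], (v ++ w); split=> //; first exact: transduces_nil.
    by rewrite [u']e; exact: (transduces_cons dq tz).
  have [q3 [v1 [v2 [t1 t2 ->]]]] := IH _ _ e.
  exists q3, (v ++ v1), v2; split; rewrite ?catA //.
  exact: (transduces_cons dq t1).
(* A move that reads nothing at the cut is attributed to the left part of the run. *)
have [q3 [v1 [v2 [t1 t2 ->]]]] := IH _ _ e.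
exists q3, (v ++ v1), v2; split; rewrite ?catA //.
exact: (transduces_cons dq t1).
Qed.

End Transducer.

(** The triple construction. A variable [(q, X, q')] derives the outputs of
    the runs from [q] to [q'] reading a word derived from [X], a piece of a
    right-hand side. Since a run may output unboundedly many words without
    reading, terminals of [X] are consumed one transition at a time from either
    end; only the two ends are touched so that no splitting of [X], which would
    be a special production, is needed when [X] has at most one variable. *)
Section TransducedGrammar.
Variables (T1 T2 Q V I : Type) (delta : Q -> option T1 -> seq T2 -> Q -> Prop).
Variables (P : production T1 V I -> Prop) (K : nat).

Local Notation piece := (K.-bseq (V + T1)).
Local Notation state := (Q * piece * Q)%type.

(** Ways to cover a right-hand side by triples. With flag [false] it stays whole in one variable;
    with flag [true] it is cut into single symbols, followed by an empty piece for the final moves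
    that read nothing. The flag will be the specialness of the original production. *)
Inductive linked : bool -> Q -> seq (V + T1) -> Q -> seq (state + T2) -> Prop :=
| linked_whole q (X : piece) q' : linked false q X q' [:: inl (q, X, q')]
| linked_nil q (X : piece) q' :
    val X = [::] -> linked true q [::] q' [:: inl (q, X, q')]
| linked_cons q (X : piece) q1 s nu q' r :
    val X = [:: s] -> linked true q1 nu q' r ->
    linked true q (s :: nu) q' (inl (q, X, q1) :: r).

Lemma linked_special b q nu q' r A : linked b q nu q' r ->
  special (Plain I A r) -> b.
Proof. by case. Qed.

Lemma linked_size b q nu q' r : linked b q nu q' r -> size r <= (size nu).+1.
Proof. by elim. Qed.

(** Terminals at the ends of a piece are consumed by productions with one variable. A production of
    [P] is simulated only once the piece is a single variable, and the result is special only if the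
    original is. *)
Inductive transduced : production T2 state I -> Prop :=
| transduced_nil q X : val X = [::] -> transduced (Plain _ (q, X, q) [::])
| transduced_left q o v q1 X Y q' :
    delta q o v q1 -> val X = [seq inr b | b <- seq_of_opt o] ++ val Y ->
    transduced (Plain _ (q, X, q') ([seq inr a | a <- v] ++ [:: inl (q1, Y, q')]))
| transduced_right q o v q1 X Y q' :
    delta q1 o v q' -> val X = val Y ++ [seq inr b | b <- seq_of_opt o] ->
    transduced (Plain _ (q, X, q') (inl (q, Y, q1) :: [seq inr a | a <- v]))
| transduced_plain C nu q X q' r :
    P (Plain _ C nu) -> val X = [:: inl C] ->
    linked (special (Plain I C nu)) q nu q' r ->
    transduced (Plain _ (q, X, q') r)
| transduced_push C B f q X Y q' :
    P (Push _ C B f) -> val X = [:: inl C] -> val Y = [:: inl B] ->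
    transduced (Push _ (q, X, q') (q, Y, q') f)
| transduced_pop C f nu q X q' r :
    P (Pop C f nu) -> val X = [:: inl C] ->
    linked (special (Pop C f nu)) q nu q' r ->
    transduced (Pop (q, X, q') f r).

(** The projection to the original grammar: a tree of a triple comes from a forest of its piece,
    with at least as many special productions, and a run on the word of that forest. *)
Definition block_sem (A : state) (alpha : seq I) (n : nat) (v : seq T2) : Prop :=
  exists n' u, [/\ n <= n', yields P n' (distribute alpha (val A.1.2)) u
                 & transduces delta A.1.1 u v A.2].

Lemma linked_sem alpha b q nu q' r n v :
  linked b q nu q' r -> form_sem block_sem (distribute alpha r) n v ->
  exists n' u, [/\ n <= n', yields P n' (distribute alpha nu) u
                 & transduces delta q u v q'].
Proof.
move=> lk; elim: lk n v => {b q nu q' r}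
    [q X q'|q X q' X0|q X q1 s nu q' r Xs _ IH] n v.
- by rewrite form_sem_variable.
- rewrite form_sem_variable => -[n' [u [le yu tu]]].
  by exists n', u; rewrite /= X0 in yu.
move=> [n1 [n2 [v1 [v2 [-> -> [m1 [u1 [/= le1 y1 t1]]]]]]]].
rewrite -/(form_sem _ _ _ _) => /IH[m2 [u2 [le2 y2 t2]]].
exists (m1 + m2), (u1 ++ u2); split; first exact: leq_add.
  by rewrite Xs in y1; exact: (yields_cat y1 y2).
exact: transduces_cat t1 t2.
Qed.

Lemma transduced_sound n x v :
  yields transduced n x v -> form_sem block_sem x n v.
Proof.
apply: yields_sound => {n x v} p A alpha w n v tp; case: tp w
    => [q X X0|q o u q1 X Y q' dq XY|q o u q1 X Y q' dq XY
       |C nu q X q' r Pp XC lk|C B f q X Y q' Pp XC YB|C f nu q X q' r Pp XC lk] w rw;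
    inversion rw; subst; rewrite /block_sem /=.
- move=> [-> ->]; exists 0, [::]; rewrite X0; split=> //; first exact: yields_nil.
  exact: transduces_nil.
- rewrite distribute_cat distribute_terminals.
  move=> /form_sem_terminals[v' ->]; rewrite form_sem_variable.
  move=> [m [z [/= le yz tz]]].
  exists m, (seq_of_opt o ++ z); split; last exact: transduces_cons dq tz.
    by rewrite /special /= count_cat /= count_map (@eq_count _ _ pred0) // count_pred0.
  by rewrite XY distribute_cat distribute_terminals -[m]add0n;
     apply: yields_cat (yields_terminals _ _) yz.
- rewrite distribute_terminals => -[n1 [n2 [v1 [v2 [-> ->]]]]].
  rewrite /block_sem /= => -[m [z [le yz tz]]].
  rewrite -[map _ _]cats0 => /form_sem_terminals[v' -> [-> ->]].
  exists m, (z ++ seq_of_opt o); rewrite addn0 cats0; split.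
  + by rewrite /special /= count_map (@eq_count _ _ pred0) // count_pred0.
  + rewrite XY distribute_cat distribute_terminals -[m]addn0.
    exact: yields_cat yz (yields_terminals _ _).
  exact: transduces_cat tz (transduces1 dq).
- move=> /(linked_sem lk)[m [z [le yz tz]]].
  (* An unsplit right-hand side is a single variable, so the new production counts only where the
     old one does. *)
  exists (special (Plain I C nu) + m), z; split=> //.
    apply: leq_add => //; move: (linked_special (A := (q, X, q')) lk).
    by case: (special (Plain I _ r)) => // ->.
  by rewrite XC; apply: yields_step Pp (rewrites_plain _ _ _) yz.
- move=> [n1 [n2 [v1 [v2 [-> -> [m [z [/= le yz tz]]] [-> ->]]]]]].
  exists m, z; rewrite cats0 XC addn0; split=> //.
  by rewrite YB in yz; exact: (yields_step Pp (rewrites_push _ _ _ _ _) yz).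
- move=> /(linked_sem lk)[m [z [le yz tz]]].
  exists (special (Pop C f nu) + m), z; split=> //.
    apply: leq_add => //; move: (linked_special (A := (q, X, q')) lk).
    by rewrite /special /=; case: (2 <= count _ r) => // ->.
  by rewrite XC; apply: yields_step Pp (rewrites_pop _ _ _ _) yz.
Qed.

(** The count is forgotten: completeness concerns words only, and the bound comes from soundness. *)
Definition derives (A : state) (alpha : seq I) (v : seq T2) : Prop :=
  exists n, yields transduced n [:: inl (A, alpha)] v.

Lemma derives_step p A alpha w n v :
  transduced p -> rewrites p A alpha w -> yields transduced n w v ->
  derives A alpha v.
Proof. by move=> tp rw yw; exists (special p + n); apply: yields_step rw yw. Qed.

Lemma size_val (X : piece) : size (val X) <= K.
Proof. exact: size_bseq. Qed.

Lemma exists_bseq (X : Type) (nu : seq X) :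
  size nu <= K -> exists X : K.-bseq X, val X = nu.
Proof. by move=> le; exists (Bseq le). Qed.

(** The intermediate pieces are suffixes of [X], hence still of length at most [K]. *)
Lemma derives_left q u v q1 (X Y : piece) q' alpha w :
  transduces delta q u v q1 -> val X = [seq inr b | b <- u] ++ val Y ->
  derives (q1, Y, q') alpha w -> derives (q, X, q') alpha (v ++ w).
Proof.
move=> tu; elim: tu X => {q u v q1} [q|q o v q1 u v' q2 dq _ IH] X.
  by move=> /val_inj ->.
rewrite map_cat -catA => XY dY.
have [|Z ZY] := @exists_bseq _ ([seq inr b | b <- u] ++ val Y).
  by apply: leq_trans (size_val X); rewrite XY !size_cat leq_addl.
have [n yZ] := IH _ ZY dY.
rewrite -ZY in XY.
apply: derives_step (transduced_left q' dq XY) (rewrites_plain _ _ _) _.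
rewrite distribute_cat distribute_terminals -catA.
exact: yields_cat (yields_terminals _ _) yZ.
Qed.

(** The induction follows the run from its first transition, which the derivation applies last
    because the right end of the piece is peeled first. *)
Lemma derives_right q u v q1 (X Y : piece) q0 alpha w :
  transduces delta q u v q1 -> val X = val Y ++ [seq inr b | b <- u] ->
  derives (q0, Y, q) alpha w -> derives (q0, X, q1) alpha (w ++ v).
Proof.
move=> tu; elim: tu Y w => {q u v q1} [q|q o v q1 u v' q2 dq _ IH] Y w.
  by rewrite !cats0 => /val_inj ->.
rewrite map_cat catA => XY [n yY].
have [|Z ZY] := @exists_bseq _ (val Y ++ [seq inr b | b <- seq_of_opt o]).
  by apply: leq_trans (size_val X); rewrite XY !size_cat leq_addr.
rewrite catA; apply: (IH Z); first by rewrite ZY.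
apply: derives_step (transduced_right q0 dq ZY) (rewrites_plain _ _ _) _.
by rewrite /= distribute_terminals; exact: (yields_cat yY (yields_terminals _ _)).
Qed.

(** A run cut along the symbols of a right-hand side, before deciding whether that side is split.
    The last link allows moves that read nothing. *)
Inductive chain (alpha : seq I) : Q -> seq (V + T1) -> seq T2 -> Q -> Prop :=
| chain_nil q v q' : transduces delta q [::] v q' -> chain alpha q [::] v q'
| chain_terminal q b v q1 nu w q' :
    transduces delta q [:: b] v q1 -> chain alpha q1 nu w q' ->
    chain alpha q (inr b :: nu) (v ++ w) q'
| chain_variable q C v q1 nu w q' :
    (forall X, val X = [:: inl C] -> derives (q, X, q1) alpha v) ->
    chain alpha q1 nu w q' -> chain alpha q (inl C :: nu) (v ++ w) q'.

Local Notation var_count := (count (fun s : V + T1 => if s is inl _ then true else false)).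

Lemma chain_terminals alpha q nu v q' :
  chain alpha q nu v q' -> var_count nu = 0 ->
  exists2 u, nu = [seq inr b | b <- u] & transduces delta q u v q'.
Proof.
elim=> {q nu v q'} [q v q' tv _|q b v q1 nu w q' tb _ IH /= /IH[u -> tu]|//].
  by exists [::].
by exists (b :: u) => //; apply: transduces_cat tb tu.
Qed.

Lemma derives_terminals q u v q' (X : piece) alpha :
  transduces delta q u v q' -> val X = [seq inr b | b <- u] ->
  derives (q, X, q') alpha v.
Proof.
move=> tu Xu; have [//|Y Y0] := @exists_bseq (V + T1)%type [::].
rewrite -[v]cats0; apply: (derives_left (Y := Y) tu); first by rewrite Y0 cats0.
apply: derives_step (transduced_nil _ Y0) (rewrites_plain _ _ _) _; exact: yields_nil.
Qed.

Lemma chain_whole alpha q nu v q' (X : piece) :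
  chain alpha q nu v q' -> var_count nu <= 1 -> val X = nu ->
  derives (q, X, q') alpha v.
Proof.
move=> ch; elim: ch X => {q nu v q'}
    [q v q' tv|q b v q1 nu w q' tb _ IH|q C v q1 nu w q' dC ch _] X.
- by move=> _; apply: (derives_terminals _ tv).
- move=> le XE; have [|Y Ynu] := @exists_bseq _ nu.
    by apply: leq_trans (size_val X); rewrite XE.
  by apply: derives_left tb _ (IH _ le Ynu); rewrite XE Ynu.
(* The variable just met is the only one, so the rest is a terminal word. *)
rewrite [count _ _]/= add1n ltnS leqn0 => /eqP.
move=> /(chain_terminals ch)[u -> tu] XE.
have [|Y Ynu] := @exists_bseq _ [:: inl C : V + T1].
  by apply: leq_trans (size_val X); rewrite XE.
by apply: derives_right tu _ (dC _ Ynu); rewrite XE Ynu.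
Qed.

Lemma chain_linked alpha q nu v q' :
  0 < K -> chain alpha q nu v q' -> exists r n,
    linked true q nu q' r /\ yields transduced n (distribute alpha r) v.
Proof.
move=> K0; elim=> {q nu v q'}
    [q v q' tv|q b v q1 nu w q' tb _|q C v q1 nu w q' dC _].
- have [//|X X0] := @exists_bseq (V + T1)%type [::].
  have [n yX] := derives_terminals alpha tv X0.
  by exists [:: inl (q, X, q')], n; split=> //; apply: linked_nil.
- move=> [r [n [lk yr]]].
  have [//|X Xb] := @exists_bseq _ [:: inr b : V + T1].
  have [m yX] := @derives_terminals _ [:: b] _ _ _ alpha tb Xb.
  exists (inl (q, X, q1) :: r), (m + n); split; first exact: linked_cons.
  exact: (yields_cat yX yr).
move=> [r [n [lk yr]]].
have [//|X XC] := @exists_bseq _ [:: inl C : V + T1].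
have [m yX] := dC X XC.
exists (inl (q, X, q1) :: r), (m + n); split; first exact: linked_cons.
exact: (yields_cat yX yr).
Qed.

Lemma chain_rhs alpha q nu v q' :
  0 < K -> size nu <= K -> chain alpha q nu v q' -> exists r n,
    linked (2 <= var_count nu) q nu q' r /\ yields transduced n (distribute alpha r) v.
Proof.
move=> K0 le ch; case: ltnP => sp; first exact: chain_linked.
have [X XE] := exists_bseq le; have [n yX] := chain_whole ch sp XE.
by exists [:: inl (q, X, q')], n; split=> //; rewrite -XE; apply: linked_whole.
Qed.

(** Induction on the forest works for forms whose blocks share one stack, and every rewriting step
    produces such a form. *)
Lemma transduced_complete n x u alpha nu q v q' :
  0 < K -> (forall p, P p -> rhs_size p <= K) ->
  yields P n x u -> x = distribute alpha nu -> transduces delta q u v q' ->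
  chain alpha q nu v q'.
Proof.
move=> K0 bP yx; elim: yx alpha nu q v q' => {n x u}
    [|n a x u _ IH|p A beta w n1 u1 n2 x u2 Pp rw _ IH1 _ IH2] alpha nu q v q'.
- by case: nu => // _; apply: chain_nil.
- case: nu => [|[C|b] nu] //= [<- xE].
  rewrite -[_ :: u]cat1s => tu; have [q1 [v1 [v2 [t1 t2 ->]]]] := transduces_catP tu.
  exact: chain_terminal t1 (IH _ _ _ _ _ xE t2).
case: nu => [|[C|b] nu] //= [AC ba xE]; subst C beta.
move=> tu; have [q1 [v1 [v2 [t1 t2 ->]]]] := transduces_catP tu.
apply: chain_variable (IH2 _ _ _ _ _ xE t2) => X XA.
have bp := bP _ Pp.
inversion rw; subst.
- have [r [n [lk yr]]] := chain_rhs K0 bp (IH1 _ _ _ _ _ erefl t1).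
  exact: derives_step (transduced_plain Pp XA lk) (rewrites_plain _ _ _) yr.
- have [//|Y YB] := @exists_bseq _ [:: inl B : V + T1].
  (* A push counts as the right-hand side [[:: inl B]] under the longer stack, and is never
     split. *)
  have [|n yY] := chain_whole (IH1 _ [:: inl B] _ _ _ erefl t1) _ YB; first by [].
  exact: derives_step (transduced_push _ _ Pp XA YB) (rewrites_push _ _ _ _ _) yY.
have [r [n [lk yr]]] := chain_rhs K0 bp (IH1 _ _ _ _ _ erefl t1).
exact: derives_step (transduced_pop Pp XA lk) (rewrites_pop _ _ _ _) yr.
Qed.

Lemma transducedP S X q q' v : 0 < K -> (forall p, P p -> rhs_size p <= K) ->
  val X = [:: inl S] ->
  (exists n, yields transduced n [:: inl (q, X, q', [::])] v) <->
  exists n u, yields P n [:: inl (S, [::])] u /\ transduces delta q u v q'.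
Proof.
move=> K0 bP XS; split=> [[n /transduced_sound]|[n [u [yu tu]]]].
  by rewrite form_sem_variable /block_sem /= XS => -[m [u [_ yu tu]]]; exists m, u.
exact: chain_whole (transduced_complete K0 bP yu (_ : _ = distribute _ [:: inl S]) tu) _ XS.
Qed.

Lemma transduced_bounded D : (forall p, P p -> rhs_size p <= K) ->
  (forall q o v q', delta q o v q' -> size v <= D) -> bounded_productions transduced.
Proof.
move=> bP bD; exists (K + D).+1 => p tp.
case: tp => [//|q o v q1 X Y q' dq _|q o v q1 X Y q' dq _|C nu q X q' r Pp _ lk
       |//|C f nu q X q' r Pp _ lk] /=.
- by rewrite size_cat size_map addn1 ltnS (leq_trans (bD _ _ _ _ dq)) ?leq_addl.
- by rewrite size_map ltnS (leq_trans (bD _ _ _ _ dq)) ?leq_addl.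
- by apply: leq_trans (linked_size lk) _; rewrite ltnS (leq_trans (bP _ Pp)) ?leq_addr.
- by apply: leq_trans (linked_size lk) _; rewrite ltnS (leq_trans (bP _ Pp)) ?leq_addr.
Qed.

End TransducedGrammar.

(** The bound [D] on the output of one move keeps the set of productions finite; the bound 1 on
    special productions is inherited through the projection. *)
Lemma IND_UFIN1_transduction (T1 T2 Q : finType)
    (delta : Q -> option T1 -> seq T2 -> Q -> Prop) (D : nat) (q0 qf : Q)
    (L : language T1) :
  (forall q o v q', delta q o v q' -> size v <= D) -> IND_UFIN1 T1 L ->
  IND_UFIN1 T2 [set v | exists2 u, L u & transduces delta q0 u v qf].
Proof.
move=> bD /IND_UFIN1_elim[V [I [P [S [[K' bP'] le1 LP]]]]].
have [K K0 bP] : exists2 K, 0 < K & forall p, P p -> rhs_size p <= K.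
  (* The successor makes [K] positive, so that pieces with one symbol exist. *)
  by exists K'.+1 => // p /bP'; apply: leqW.
have [|X XS] := @exists_bseq K _ [:: inl S : V + T1]; first by [].
apply: (@IND_UFIN1_intro _ _ _ (@transduced _ _ _ _ _ delta P K) (q0, X, qf)).
- exact: transduced_bounded bP bD.
- move=> n v /transduced_sound; rewrite form_sem_variable => -[m [u [/leq_trans le yu _]]].
  by move: yu; rewrite /= XS => /le1/le.
move=> v; rewrite (transducedP _ _ _ _ K0 bP XS); split.
  by move=> [u /LP[n yu] tu]; exists n, u.
by move=> [n [u [yu tu]]]; exists u => //; apply/LP; exists n.
Qed.

(** * The full trio operations as transductions *)

Lemma morphism_bounded (T1 : finType) (T2 : Type) (h : seq T1 -> seq T2) :
  exists D, forall a, size (h [:: a]) <= D.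
Proof.
exists (\max_(a : T1) size (h [:: a])) => a.
exact: (@leq_bigmax _ (fun a => size (h [:: a]))).
Qed.

(** A transducer with one state replaces each letter by its image. *)
Lemma IND_UFIN1_morphism : closed_morphism IND_UFIN1.
Proof.
move=> T1 T2 h L [h0 hD] FL; have [D bD] := morphism_bounded h.
pose delta (q : unit) o v (q' : unit) := exists2 b : T1, o = Some b & v = h [:: b].
suff -> : h @` L = [set v | exists2 u, L u & transduces delta tt u v tt].
  by apply: (IND_UFIN1_transduction (D := D)) FL => q o v q' [b _ ->].
have tP u v : transduces delta tt u v tt <-> v = h u.
  split=> [|->].
    move: {1 2}tt => q tu; elim: tu => {q u v} [q|q o v q1 u w q2 [b -> ->] _ ->//].
    by rewrite h0.
  elim: u => [|b u IH]; first by rewrite h0; exact: transduces_nil.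
  rewrite -cat1s hD; apply: (transduces_cons (o := Some b) _ IH).
  by exists b.
apply/seteqP; split=> v /= [u Lu].
  by move=> <-; exists u => //; apply/tP.
by move=> /tP ->; exists u.
Qed.

(** The transducer guesses the letters [a] of the output, and keeps in its
    state the part of [h [:: a]] that remains to be read. *)
Lemma IND_UFIN1_inverse_morphism : closed_inverse_morphism IND_UFIN1.
Proof.
move=> T1 T2 h L [h0 hD] FL; have [D bD] := morphism_bounded h.
pose delta (q : D.-bseq T2) (o : option T2) (v : seq T1) (q' : D.-bseq T2) :=
  (exists a, [/\ o = None, v = [:: a], val q = [::] & val q' = h [:: a]]) \/
  (exists b, [/\ o = Some b, v = [::] & val q = b :: val q']).
have [//|q0 q00] := @exists_bseq D T2 [::].
suff -> : h @^-1` L = [set v | exists2 u, L u & transduces delta q0 u v q0].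
  apply: (IND_UFIN1_transduction (D := 1)) FL => q o v q'.
  by case=> [[a [_ -> _ _]]|[b [_ -> _]]].
(* Generalised to any starting state: the input is the pending remainder followed by the image of
   the output. *)
have tP q u v : transduces delta q u v q0 <-> u = val q ++ h v.
  split=> [|->].
    move e: q0 => q' tu; elim: tu e => {q u v q'} [q <-|]; first by rewrite h0 cats0 q00.
    move=> q o v q1 u w q2 dq _ IH /IH ->.
    case: dq => [[a [-> -> -> ->]]|[b [-> -> ->]]] //.
    by rewrite hD.
  have tread (q1 : D.-bseq T2) : transduces delta q1 (val q1) [::] q0.
    move e: (val q1) => z; elim: z q1 e => [|b z IH] q1 e.
      have -> : q1 = q0 by apply: val_inj; rewrite e q00.
      exact: transduces_nil.
    have [|q2 q2z] := @exists_bseq D _ z.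
      by apply: leq_trans (size_bseq q1); rewrite -[size q1]/(size (val q1)) e.
    apply: (transduces_cons (o := Some b) (v := [::]) _ (IH _ q2z)).
    by right; exists b; rewrite e q2z.
  rewrite -[X in transduces _ _ X _]cat0s; apply: transduces_cat (tread q) _.
  elim: v => [|a v IH]; first by rewrite h0; exact: transduces_nil.
  have [q1 q1a] := exists_bseq (bD a).
  rewrite -cat1s hD -q1a; apply: (transduces_cat _ IH).
  apply: (@transduces_cons _ _ _ _ _ None [:: a] _ _ _ _ _ (tread q1)).
  by left; exists a.
apply/seteqP; split=> v /=.
  by move=> Lv; exists (h v) => //; apply/tP; rewrite q00.
by move=> [u Lu /tP uE]; rewrite uE q00 in Lu.
Qed.

(** The automaton copies its input. A silent move from its final states to the extra state [None]
    provides a single accepting state without exits. *)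
Lemma IND_UFIN1_regular_intersection : closed_regular_intersection IND_UFIN1.
Proof.
move=> T L R [Q [q0 [d [final ->]]]] FL.
pose delta (s : option Q) (o : option T) (v : seq T) (s' : option Q) :=
  if s is Some q then
    (exists b, [/\ o = Some b, v = [:: b] & s' = Some (d q b)]) \/
    [/\ o = None, v = [::], s' = None & final q]
  else False.
suff -> : L `&` [set w | final (foldl d q0 w)] =
    [set v | exists2 u, L u & transduces delta (Some q0) u v None].
  apply: (IND_UFIN1_transduction (D := 1)) FL => -[q|//] o v q'.
  by case=> [[b [_ -> _]]|[_ -> _ _]].
have tP q u v : transduces delta (Some q) u v None <-> u = v /\ final (foldl d q u).
  split=> [|[<-]].
    suff gen s s' : transduces delta s u v s' -> s' = None ->
        if s is Some q1 then u = v /\ final (foldl d q1 u) else u = [::] /\ v = [::].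
      by move=> /gen; apply.
    elim=> {s u v s'} [s ->//|s o v s1 u w s2 ds _ IH /IH {IH}].
    case: s ds => [q1|//] [[b [-> -> ->]]|[-> -> -> fq]] /=.
      by move=> [-> ?].
    by move=> [-> ->].
  elim: u q => [|b u IH] q /= fq.
    rewrite -[X in transduces _ _ X _ _]/(seq_of_opt None ++ [::]).
    rewrite -[X in transduces _ _ _ X _]cats0.
    by apply: transduces_cons (transduces_nil _ _); right.
  rewrite -[X in transduces _ _ X _ _]/(seq_of_opt (Some b) ++ u).
  rewrite -[X in transduces _ _ _ X _]cat1s.
  by apply: transduces_cons (IH _ fq); left; exists b.
apply/seteqP; split=> v /=.
  by move=> [Lv fv]; exists v => //; apply/tP.
by move=> [u Lu /tP[<- fu]].
Qed.

(** * Renaming of variables and indices, and closure under union *)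

Section Embedding.
Variables (T V V' I I' : Type) (f : V -> V') (g : I -> I').

Definition map_symbols (nu : seq (V + T)) : seq (V' + T) :=
  [seq match s with inl A => inl (f A) | inr a => inr a end | s <- nu].

Definition map_production (p : production T V I) : production T V' I' :=
  match p with
  | Plain A nu => Plain _ (f A) (map_symbols nu)
  | Push A B i => Push _ (f A) (f B) (g i)
  | Pop A i nu => Pop (f A) (g i) (map_symbols nu)
  end.

Definition map_form (x : sentential T V I) : sentential T V' I' :=
  [seq match s with
       | inl (A, alpha) => inl (f A, map g alpha)
       | inr a => inr a
       end | s <- x].

Lemma special_map p : special (map_production p) = special p.
Proof.
by case: p => [A nu|//|A i nu]; rewrite /special /= count_map; congr (_ <= _);
   apply: eq_count => -[].
Qed.

Lemma rhs_size_map p : rhs_size (map_production p) = rhs_size p.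
Proof. by case: p => [A nu|//|A i nu] /=; rewrite size_map. Qed.

Lemma distribute_map alpha nu :
  distribute (map g alpha) (map_symbols nu) = map_form (distribute alpha nu).
Proof. by rewrite /distribute /map_form /map_symbols -!map_comp; apply: eq_map => -[]. Qed.

Lemma rewrites_map p A alpha w :
  rewrites p A alpha w -> rewrites (map_production p) (f A) (map g alpha) (map_form w).
Proof.
by case=> [B nu beta|B C i beta|B i nu beta]; rewrite -?distribute_map; constructor.
Qed.

(** Injectivity of both renamings allows a step of the renamed production to be pulled back. *)
Lemma rewrites_mapP p A alpha w : injective f -> injective g ->
  rewrites (map_production p) (f A) (map g alpha) w ->
  exists2 w', rewrites p A alpha w' & w = map_form w'.
Proof.
move=> fI gI; case: p => [B nu|B C i|B i nu] rw; inversion rw; subst.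
- by rewrite -(fI _ _ H) distribute_map; eexists; first exact: rewrites_plain.
- by rewrite -(fI _ _ H); eexists; first exact: rewrites_push.
case: alpha rw H4 => [//|j alpha] rw [/gI <- ->].
by rewrite -(fI _ _ H) distribute_map; eexists; first exact: rewrites_pop.
Qed.

Lemma yields_map P P' n x u :
  (forall p, P p -> P' (map_production p)) -> yields P n x u ->
  yields P' n (map_form x) u.
Proof.
move=> PP'; elim=> {n x u} [|n a x u _ IH|p A alpha w n1 u1 n2 x u2 Pp rw _ IH1 _ IH2] /=.
- exact: yields_nil.
- exact: yields_terminal.
- by rewrite -special_map; apply: yields_variable (PP' _ Pp) (rewrites_map rw) IH1 IH2.
Qed.

Lemma form_sem_map P sem n x u :
  (forall A alpha m v, sem (f A) (map g alpha) m v -> yields P m [:: inl (A, alpha)] v) ->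
  form_sem sem (map_form x) n u -> yields P n x u.
Proof.
move=> semP; elim: x n u => [|[[A alpha]|a] x IH] n u /=.
- by move=> [-> ->]; exact: yields_nil.
- move=> [n1 [n2 [u1 [u2 [-> -> /semP y1 /IH y2]]]]].
  exact: (yields_cat y1 y2).
by move=> [v -> /IH]; exact: yields_terminal.
Qed.

End Embedding.

Section Union.
Variables (T V1 V2 I1 I2 : Type).
Variables (P1 : production T V1 I1 -> Prop) (P2 : production T V2 I2 -> Prop).
Variables (S1 : V1) (S2 : V2).

Local Notation left_symbol := (fun A : V1 => Some (inl A) : option (V1 + V2)).
Local Notation right_symbol := (fun A : V2 => Some (inr A) : option (V1 + V2)).

Inductive union_production : production T (option (V1 + V2)) (I1 + I2) -> Prop :=
| union_start1 : union_production (Plain _ None [:: inl (Some (inl S1))])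
| union_start2 : union_production (Plain _ None [:: inl (Some (inr S2))])
| union_left p : P1 p -> union_production (map_production left_symbol inl p)
| union_right p : P2 p -> union_production (map_production right_symbol inr p).

(** A component variable is constrained only on stacks over its own indices, and the new start only
    on the empty stack; no other blocks are reachable from the start. *)
Definition union_sem (A : option (V1 + V2)) (alpha : seq (I1 + I2)) (n : nat)
    (u : seq T) : Prop :=
  match A with
  | None => alpha = [::] ->
      yields P1 n [:: inl (S1, [::])] u \/ yields P2 n [:: inl (S2, [::])] u
  | Some (inl B) => forall beta, alpha = map inl beta -> yields P1 n [:: inl (B, beta)] u
  | Some (inr B) => forall beta, alpha = map inr beta -> yields P2 n [:: inl (B, beta)] u
  end.

Lemma union_sound n x u : yields union_production n x u -> form_sem union_sem x n u.
Proof.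
have inl_inj : injective left_symbol by move=> ? ? [].
have inr_inj : injective right_symbol by move=> ? ? [].
have inlI : injective (@inl I1 I2) by move=> ? ? [].
have inrI : injective (@inr I1 I2) by move=> ? ? [].
apply: yields_sound => {n x u} p A alpha w n u up; case: up w => [| |q Pq|q Pq] w rw.
- by inversion rw; subst; rewrite form_sem_variable => sS a0; left; apply: sS; rewrite a0.
- by inversion rw; subst; rewrite form_sem_variable => sS a0; right; apply: sS; rewrite a0.
- have [B AB] : exists B, A = Some (inl B) by case: q {Pq} rw
       => [? ?|? ? ?|? ? ?] rw; inversion rw; eexists.
  subst A => sw beta ab; subst alpha.
  have [w' rw' wE] := rewrites_mapP inl_inj inlI rw; subst w.
  rewrite special_map; apply: (yields_step Pq rw'); apply: form_sem_map sw.
  by move=> C gamma m v; apply.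
- have [B AB] : exists B, A = Some (inr B) by case: q {Pq} rw
       => [? ?|? ? ?|? ? ?] rw; inversion rw; eexists.
  subst A => sw beta ab; subst alpha.
  have [w' rw' wE] := rewrites_mapP inr_inj inrI rw; subst w.
  rewrite special_map; apply: (yields_step Pq rw'); apply: form_sem_map sw.
  by move=> C gamma m v; apply.
Qed.

End Union.

Lemma IND_UFIN1_union : closed_union IND_UFIN1.
Proof.
move=> T L1 L2 /IND_UFIN1_elim[V1 [I1 [P1 [S1 [[K1 b1] le1 L1P]]]]].
move=> /IND_UFIN1_elim[V2 [I2 [P2 [S2 [[K2 b2] le2 L2P]]]]].
apply: (@IND_UFIN1_intro _ _ _ (union_production P1 P2 S1 S2) None).
- exists (K1 + K2).+1 => p up; case: up => [//|//|q /b1|q /b2] le; rewrite rhs_size_map.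
    by apply: leq_trans le _; rewrite leqW // leq_addr.
  by apply: leq_trans le _; rewrite leqW // leq_addl.
- move=> n u yu; have := union_sound yu; rewrite form_sem_variable => /(_ erefl).
  by case=> {}yu; [apply: le1 yu|apply: le2 yu].
move=> u; split=> [[/L1P|/L2P] [n yu]|[n yu]].
- exists n; have {}yu := yields_map (@union_left _ _ _ _ _ P1 P2 S1 S2) yu.
  exact: (yields_step (@union_start1 _ _ _ _ _ P1 P2 S1 S2) (rewrites_plain _ _ _) yu).
- exists n; have {}yu := yields_map (@union_right _ _ _ _ _ P1 P2 S1 S2) yu.
  exact: (yields_step (@union_start2 _ _ _ _ _ P1 P2 S1 S2) (rewrites_plain _ _ _) yu).
have := union_sound yu; rewrite form_sem_variable => /(_ erefl).
by case=> {}yu; [left; apply/L1P|right; apply/L2P]; exists n.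
Qed.

Lemma IND_UFIN1_set0 (T : finType) : IND_UFIN1 T set0.
Proof.
apply: (@IND_UFIN1_intro T unit void (fun=> False) tt); first by exists 0.
  by move=> n u yu; have [p [w [m []]]] := yields_variableP yu.
by move=> u; split=> [//|[n yu]]; have [p [w [m []]]] := yields_variableP yu.
Qed.

Lemma IND_UFIN1_bigcup (T : finType) m (F : 'I_m -> language T) :
  (forall j, IND_UFIN1 T (F j)) -> IND_UFIN1 T (\bigcup_j F j).
Proof.
elim: m F => [|m IH] F FF.
  by rewrite (_ : \bigcup_j _ = set0); [exact: IND_UFIN1_set0|apply/seteqP; split=> u // [[]]].
rewrite (_ : \bigcup_j _ = F ord0 `|` \bigcup_j F (lift ord0 j)).
  by apply: IND_UFIN1_union => //; apply: IH.
apply/seteqP; split=> u.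
  move=> [j _]; case: (unliftP ord0 j) => [i ->|->] Fu; last by left.
  by right; exists i.
by move=> [Fu|[j _ Fu]]; [exists ord0|exists (lift ord0 j)].
Qed.

(** * Linear and semi-linear sets *)

Lemma word_powerD (T : Type) (u : seq T) m n :
  word_power u (m + n) = word_power u m ++ word_power u n.
Proof. by rewrite /word_power nseqD flatten_cat. Qed.

Section Linear.
Variables (T : Type) (k n : nat) (u : 'I_k -> seq T).
Variables (b0 : 'rV[nat]_k) (b : 'I_n -> 'rV[nat]_k).

Local Notation opener := (Some None : option (option 'I_k)).
Local Notation reader := (fun j => Some (Some j) : option (option 'I_k)).

(** The stack collects one index [Some i] for every use of the period [b i],
    above the bottom marker [None]; the only special production then copies it
    to [k] readers, the [j]-th of which turns it into a power of [u j]. *)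
Inductive linear_production : production T (option (option 'I_k)) (option 'I_n) -> Prop :=
| linear_bottom : linear_production (Push _ None opener None)
| linear_push i : linear_production (Push _ opener opener (Some i))
| linear_split :
    linear_production (Plain _ opener [seq inl (reader j) | j <- index_enum 'I_k])
| linear_pop j i :
    linear_production (Pop (reader j) (Some i)
      ([seq inr a | a <- word_power (u j) (b i ord0 j)] ++ [:: inl (reader j)]))
| linear_stop j :
    linear_production (Pop (reader j) None
      [seq inr a | a <- word_power (u j) (b0 ord0 j)]).

Local Notation stack beta := (map Some beta ++ [:: None]).

Definition linear_point (beta : seq 'I_n) : 'rV[nat]_k :=
  (b0 + \sum_(i <- beta) b i)%R.

Lemma linear_point_cons i beta j :
  linear_point (i :: beta) ord0 j = b i ord0 j + linear_point beta ord0 j.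
Proof. by rewrite /linear_point big_cons GRing.addrCA mxE. Qed.

(** The opener may still push, so its final stack is existential; a reader's word is fixed by its
    stack. Readers have count 0, which leaves the split as the only possible special production. *)
Definition linear_sem (A : option (option 'I_k)) (alpha : seq (option 'I_n))
    (m : nat) (v : seq T) : Prop :=
  match A with
  | None => alpha = [::] ->
      m <= 1 /\ exists beta, v = word_powers u (linear_point beta)
  | Some None => forall beta, alpha = stack beta ->
      m <= 1 /\ exists beta, v = word_powers u (linear_point beta)
  | Some (Some j) => forall beta, alpha = stack beta ->
      m = 0 /\ v = word_power (u j) (linear_point beta ord0 j)
  end.

Lemma linear_sound m x v : yields linear_production m x v -> form_sem linear_sem x m v.
Proof.
apply: yields_sound => {m x v} p A alpha w m v lp.
case: lp w => [|i| |j i|j] w rw; inversion rw; subst.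
- by rewrite form_sem_variable => sA a0; apply: (sA [::]); rewrite a0.
- by rewrite form_sem_variable => sA beta ab; apply: (sA (i :: beta)); rewrite ab.
- move=> sw beta ab; subst alpha.
  (* The remaining count is the specialness of the split itself, at most 1. *)
  suff [-> vE] : m = 0 /\ v = word_powers u (linear_point beta).
    by rewrite addn0 leq_b1; split=> //; exists beta.
  rewrite /word_powers; move: sw {rw}; elim: (index_enum _) m v => [|j r IH] m v /=.
    by rewrite big_nil.
  move=> [n1 [n2 [v1 [v2 [-> -> /(_ _ erefl)[-> ->]]]]]] /IH[-> ->].
  by rewrite big_cons.
- rewrite distribute_cat distribute_terminals => /form_sem_terminals[v' ->].
  rewrite form_sem_variable => sj [//|i' beta] [ii' ab]; subst i' alpha0.
  have [-> ->] := sj _ erefl.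
  rewrite linear_point_cons word_powerD; split=> //.
  by rewrite /special /= count_cat /= count_map (@eq_count _ _ pred0) // count_pred0.
- rewrite distribute_terminals -[map _ _]cats0 => /form_sem_terminals[v' -> [-> ->]].
  move=> [|//] _; rewrite /linear_point big_nil GRing.addr0 cats0; split=> //.
  by rewrite /special /= count_map (@eq_count _ _ pred0) // count_pred0.
Qed.

Lemma linear_reader_complete j beta : exists m,
  yields linear_production m [:: inl (reader j, stack beta)]
    (word_power (u j) (linear_point beta ord0 j)).
Proof.
elim: beta => [|i beta [m IH]].
  eexists; rewrite /linear_point big_nil GRing.addr0.
  apply: (yields_step (linear_stop j) (rewrites_pop _ _ _ _)).
  by rewrite distribute_terminals; exact: yields_terminals.
eexists; apply: (yields_step (linear_pop j i) (rewrites_pop _ _ _ _)).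
rewrite distribute_cat distribute_terminals linear_point_cons word_powerD.
exact: yields_cat (yields_terminals _ _) IH.
Qed.

Lemma linear_complete beta : exists m,
  yields linear_production m [:: inl (None, [::])] (word_powers u (linear_point beta)).
Proof.
suff [m ym] : exists m, yields linear_production m [:: inl (opener, [:: None])]
    (word_powers u (linear_point beta)).
  by eexists; exact: (yields_step linear_bottom (rewrites_push _ _ _ _ _) ym).
suff : exists m, yields linear_production m [:: inl (opener, stack beta)]
    (word_powers u (linear_point beta)).
  (* A tree above the stack with [i] on top becomes, below one push, a tree above the shorter stack;
     this unwinds to the bottom marker. *)
  move: (word_powers _ _) => v; elim: beta => [//|i beta IH] [m ym]; apply: IH.
  by eexists; exact: (yields_step (linear_push i) (rewrites_push _ _ _ _ _) ym).
suff [m ym] : exists m, yields linear_production m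
    (distribute (stack beta) [seq inl (reader j) | j <- index_enum 'I_k])
    (word_powers u (linear_point beta)).
  by eexists; exact: (yields_step linear_split (rewrites_plain _ _ _) ym).
rewrite /word_powers; elim: (index_enum _) => [|j r [m IH]] /=.
  by exists 0; rewrite big_nil; exact: yields_nil.
rewrite big_cons; have [m' yj] := linear_reader_complete j beta.
by exists (m' + m); exact: (yields_cat yj IH).
Qed.

End Linear.

(** The sum is commutative, so only the number of occurrences of each index in the stack matters. *)
Lemma sum_multiplicities (V : nmodType) n (b : 'I_n -> V) beta :
  exists x : 'I_n -> nat, (\sum_(i <- beta) b i = \sum_(i < n) b i *+ x i)%R.
Proof.
elim: beta => [|j beta [x IH]].
  by exists (fun=> 0); rewrite big_nil big1.
exists (fun i => (i == j) + x i); rewrite big_cons IH.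
under [RHS]eq_bigr => i _ do rewrite GRing.mulrnDr.
rewrite big_split /=; congr (_ + _)%R; rewrite (bigD1 j) //= eqxx.
by rewrite big1 ?GRing.addr0 // => i /negbTE ->.
Qed.

Lemma multiplicities_sum (V : nmodType) n (b : 'I_n -> V) (x : 'I_n -> nat) :
  exists beta, (\sum_(i <- beta) b i = \sum_(i < n) b i *+ x i)%R.
Proof.
elim: (index_enum _) => [|j r [beta IH]]; first by exists [::]; rewrite !big_nil.
exists (nseq (x j) j ++ beta).
by rewrite big_cat big_nseq GRing.iter_addr_0 IH big_cons.
Qed.

Lemma IND_UFIN1_linear (T : finType) k (u : 'I_k -> seq T) (B : set 'rV[nat]_k) :
  linear_set B -> IND_UFIN1 T (word_powers u @` B).
Proof.
move=> [n [b0 [b ->]]].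
apply: (@IND_UFIN1_intro _ _ _ (linear_production u b0 b) None).
(* The first term bounds the words of the stopping productions, the second those of the popping
   ones; [k.+1] covers the split and the variable after a popped word. *)
- exists (\max_(j < k) size (word_power (u j) (b0 ord0 j)) +
          \max_(j < k) \max_(i < n) size (word_power (u j) (b i ord0 j)) + k.+1) => p lp.
  case: lp => [|i| |j i|j] /=; rewrite ?addnS //.
  + by rewrite size_map [index_enum _]unlock -enumT size_enum_ord leqW ?leq_addl.
  + rewrite size_cat size_map addn1 ltnS.
    apply: leq_trans (leq_addr _ _); apply: leq_trans (leq_addl _ _).
    apply: leq_trans (leq_bigmax j).
    exact: (@leq_bigmax _ (fun i => size (word_power (u j) (b i ord0 j)))).
  + rewrite size_map -!addnS -addnA; apply: leq_trans (leq_addr _ _).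
    exact: (@leq_bigmax _ (fun j => size (word_power (u j) (b0 ord0 j)))).
- by move=> m v /linear_sound; rewrite form_sem_variable => /(_ erefl)[].
move=> v; split.
  move=> [l [x _ <-] <-]; have [beta bE] := multiplicities_sum b x.
  by rewrite -bE; apply: linear_complete.
move=> [m /linear_sound]; rewrite form_sem_variable => /(_ erefl)[_ [beta ->]].
have [x xE] := sum_multiplicities b beta.
by exists (linear_point b0 b beta) => //; exists x; rewrite // -xE.
Qed.

(** The image of a union is the union of the images, so finite unions reduce the claim to the linear
    components. *)
Lemma IND_UFIN1_bounded_semilinear (T : finType) (L : language T) :
  bounded_ginsburg_semilinear L -> IND_UFIN1 T L.
Proof.
move=> [k [u [_ [B [m [C [linC ->]]] ->]]]].
rewrite image_bigcup; apply: IND_UFIN1_bigcup => j.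
exact: IND_UFIN1_linear.
Qed.

Theorem theorem24 :
  full_trio IND_UFIN1 /\ closed_union IND_UFIN1 /\
  (forall (T : finType) (L : language T),
     bounded_ginsburg_semilinear L -> IND_UFIN1 T L).
Proof.
split; last by split; [exact: IND_UFIN1_union|exact: IND_UFIN1_bounded_semilinear].
split.
- exact: IND_UFIN1_morphism.
- exact: IND_UFIN1_inverse_morphism.
- exact: IND_UFIN1_regular_intersection.
Qed.
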